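(* Let $t\geq 3$, $k\geq 3$, $1\leq n_1\leq n_2\leq\dots\leq n_t$ and $1\leq m_1\leq m_2\leq\dots\leq m_k$ be integers. Then $$\gamma_{P,c}(K_{n_1,n_2,\dots,n_t}\times K_{m_1,m_2,\dots,m_k})=\begin{cases}2, & \text{if } n_1=n_2=1 \text{ and } m_1=m_2=1,\\ 3, & \text{otherwise.}\end{cases}$$
   Context: Power domination: for $S\subseteq V(X)$, start with $M(S)=N[S]$ and repeatedly add a vertex $w$ whenever some $v\in M(S)$ has $w$ as its unique neighbour outside $M(S)$; $S$ is a connected power dominating set if the final $M(S)$ is $V(X)$ and $\langle S\rangle$ is connected; $\gamma_{P,c}(X)$ is the minimum size of such a set. The tensor product $G\times H$ has vertex set $V(G)\times V(H)$, with $(a,b)\sim(x,y)$ iff $ax\in E(G)$ and $by\in E(H)$. $K_{p_1,\dots,p_r}$ is the complete multipartite graph with partite sets of sizes $p_1,\dots,p_r$. *)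

(* Defs.v *)
From mathcomp Require Import all_boot.

Set Implicit Arguments.
Unset Strict Implicit.
Unset Printing Implicit Defensive.

(* A finite simple graph on a finType is given by its adjacency relation. *)

Section PowerDomination.

Variables (T : finType) (adj : rel T).

Definition nbhd (v : T) : {set T} := [set w | adj v w].

Definition closed_nbhd (S : {set T}) : {set T} := S :|: \bigcup_(v in S) nbhd v.

(* One application of the propagation rule: M' is M together with a vertex w
   that is the unique neighbour outside M of some v in M. *)
Definition propagates (M M' : {set T}) : bool :=
  [exists v in M, exists w,
     (nbhd v :\: M == [set w]) && (M' == w |: M)].

(* [set: T] contains every set of monitored vertices and admits no further
   propagation, so the final monitored set is [set: T] exactly when repeated
   propagation from closed_nbhd S can reach it. *)
Definition power_dominating (S : {set T}) : bool :=
  connect propagates (closed_nbhd S) [set: T].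

Definition connected_set (S : {set T}) : bool :=
  [forall u in S, forall v in S,
     connect [rel x y | [&& x \in S, y \in S & adj x y]] u v].

Definition connected_power_dominating (S : {set T}) : bool :=
  power_dominating S && connected_set S.

(* The default value #|T|.+1 exceeds the size of every subset of T: it is
   returned exactly when there is no connected power dominating set. *)
Definition gamma_Pc : nat :=
  \big[minn/#|T|.+1]_(S : {set T} | connected_power_dominating S) #|S|.

End PowerDomination.

Definition tensor_adj (T U : finType) (e : rel T) (f : rel U) : rel (T * U) :=
  fun p q => e p.1 q.1 && f p.2 q.2.

(* The vertex Tagged _ a with tag i is the a-th vertex of the i-th part. *)
Definition multipartite_vertex (r : nat) (p : r.-tuple nat) : finType :=
  {i : 'I_r & 'I_(tnth p i)}.

Definition multipartite_adj (r : nat) (p : r.-tuple nat) :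
    rel (multipartite_vertex p) :=
  fun u v => tag u != tag v.

(* Main.v *)
(* A fort is a nonempty set F such that no vertex outside F has exactly one
   neighbour in F; propagation never enters a fort, so the closed neighbourhood
   of a power dominating set meets every fort.  In a product of two complete
   multipartite graphs, the vertices not dominated by a single vertex form a
   fort.  Two adjacent vertices (a, b) and (c, d) leave exactly the blocks
   [a] x [d] and [c] x [b] undominated, where [x] is the part of x; all vertices
   of a block have the same neighbours, so a block with at least two vertices is
   a fort.  Hence two vertices suffice only if all four parts are singletons, in
   which case a third part of each factor lets propagation reach both blocks.
   Three vertices with pairwise distinct parts in both coordinates dominate
   everything: a vertex shares a coordinate part with at most two of them. *)
Require Import Defs.
From mathcomp Require Import all_boot all_order.

Set Implicit Arguments.
Unset Strict Implicit.
Unset Printing Implicit Defensive.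

(** [x] and [y] may coincide, so this also serves to avoid a single part. *)
Lemma exists_other (I : finType) (x y : I) :
  2 < #|I| -> exists z, (z != x) && (z != y).
Proof.
move=> cardI; apply/existsP; apply: contraLR cardI => /existsPn none.
rewrite -leqNgt -cardsT; apply: (@leq_trans #|[set x; y]|).
  apply/subset_leq_card/subsetP => z _; rewrite !inE.
  by have := none z; rewrite negb_and !negbK.
by rewrite cards2; case: (x != y).
Qed.

(** * Forts and general facts on power domination *)

Section PowerDominationTheory.

Variables (T : finType) (adj : rel T).
Implicit Types (S F W : {set T}) (u v w x y : T).

Lemma in_closed_nbhd S w :
  (w \in closed_nbhd adj S) = (w \in S) || [exists v in S, adj v w].
Proof.
rewrite /closed_nbhd inE; congr (_ || _); apply/bigcupP/exists_inP.
  by move=> [v vS]; rewrite inE => vw; exists v.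
by move=> [v vS vw]; exists v; rewrite ?inE.
Qed.

Lemma gamma_Pc_eq S :
    connected_power_dominating adj S ->
    (forall S', connected_power_dominating adj S' -> #|S| <= #|S'|) ->
  gamma_Pc adj = #|S|.
Proof.
move=> cpdS minS; apply/eqP; rewrite eqn_leq /gamma_Pc; apply/andP; split.
  by have := Order.TotalTheory.bigmin_le_cond #|T|.+1
    (fun X : {set T} => #|X|) cpdS; rewrite Order.NatOrder.minEnat.
elim/big_ind: _ => [|m1 m2 le1 le2|S' cpdS'].
(* The default value of the minimum, [#|T|.+1], must also be at least [#|S|]. *)
- exact/leqW/max_card.
- by rewrite leq_min le1.
- exact: minS.
Qed.

Definition fort F :=
  F != set0 /\
  forall v w, v \notin F -> w \in F -> adj v w ->
    exists w', [&& w' != w, w' \in F & adj v w'].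

(** Induction on the propagation path: the first vertex [w] of [F] to be added would be the only
    unmonitored neighbour of some [v] outside [F], but the fort supplies a second neighbour of [v]
    in [F], also unmonitored. A path to the full vertex set is thus impossible. *)
Lemma fort_not_power_dominating S F :
  fort F -> [disjoint closed_nbhd adj S & F] -> ~~ power_dominating adj S.
Proof.
move=> [/set0Pn[x xF] fortF]; apply: contraTN => /connectP[s].
move: (closed_nbhd adj S) => M; elim: s M => [|M' s IHs] M /=.
  by move=> _ <-; apply/pred0Pn; exists x; rewrite /= inE.
case/andP=> /exists_inP[v vM /existsP[w /andP[/eqP nbv /eqP defM']]].
move=> pathM' lastM'; apply/negP => disjM.
have /pred0Pn[z /andP[/= zM' zF]] := IHs M' pathM' lastM'.
move: zM'; rewrite defM' in_setU1 (disjointFl disjM zF) orbF => /eqP zw.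
have : w \in nbhd adj v :\: M by rewrite nbv set11.
rewrite !inE => /andP[_ vw].
have wF : w \in F by rewrite -zw.
have vF : v \notin F by rewrite (disjointFr disjM vM).
have [w' /and3P[w'w w'F vw']] := fortF v w vF wF vw.
have : w' \in nbhd adj v :\: M by rewrite !inE vw' (disjointFl disjM w'F).
by rewrite nbv inE (negPf w'w).
Qed.

(** With no vertex outside it, the full vertex set is vacuously a fort, and the closed neighbourhood
    of the empty set misses it. *)
Lemma power_dominating_neq0 S : 0 < #|T| -> power_dominating adj S -> S != set0.
Proof.
move=> /card_gt0P[x _]; apply: contraTneq => ->.
apply: (@fort_not_power_dominating _ setT).
  by split=> [|v w]; [apply/set0Pn; exists x | rewrite inE].
rewrite -setI_eq0 setIT; apply/eqP/setP => w; rewrite in_closed_nbhd !inE /=.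
by apply/negbTE/exists_inPn => v; rewrite inE.
Qed.

(** Propagation is read off the unmonitored set [W], which has at most two vertices where this is
    applied. *)
Lemma propagates_setC W v w :
  v \notin W -> nbhd adj v :&: W = [set w] ->
  propagates adj (~: W) (~: (W :\ w)).
Proof.
move=> vW nbv; apply/exists_inP; exists v; first by rewrite inE.
apply/existsP; exists w; rewrite setDE setCK nbv eqxx /=.
by apply/eqP/setP => x; rewrite !inE negb_and negbK.
Qed.

Lemma connected_pair_adj x y :
    irreflexive adj -> x != y -> connected_set adj [set x; y] ->
  adj x y.
Proof.
move=> irr xy /forall_inP /(_ x (set21 x y)) /forall_inP /(_ y (set22 x y)).
(* The first edge of a path from [x] to [y] stays in the pair and is not a loop, so it already ends
   at [y]. *)
case/connectP => -[|z s] /=; first by move=> _ yx; rewrite yx eqxx in xy.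
by rewrite !inE => /andP[/and3P[_ /orP[]/eqP-> xz] _]; rewrite ?irr in xz *.
Qed.

Lemma clique_connected S :
    (forall x y, x \in S -> y \in S -> x != y -> adj x y) ->
  connected_set adj S.
Proof.
move=> clique; apply/forall_inP => x xS; apply/forall_inP => y yS.
have [->|xy] := eqVneq x y; first exact: connect0.
by apply: connect1; rewrite /= xS yS clique.
Qed.

End PowerDominationTheory.

(* A complete multipartite graph is given by the map sending a vertex to its
   part; surjectivity says that all parts are nonempty. *)
Section MultipartiteProduct.

Variables (T U I J : finType) (p : T -> I) (q : U -> J).
Hypotheses (p_surj : forall i, exists x, p x = i).
Hypotheses (q_surj : forall j, exists y, q y = j).
Hypotheses (cardI : 2 < #|I|) (cardJ : 2 < #|J|).

Let adj : rel (T * U) :=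
  tensor_adj (fun x y => p x != p y) (fun x y => q x != q y).

Let adjE u v : adj u v = (p u.1 != p v.1) && (q u.2 != q v.2).
Proof. by []. Qed.

Let adj_irr : irreflexive adj.
Proof. by move=> u; rewrite adjE eqxx. Qed.

Let adj_sym : symmetric adj.
Proof. by move=> u v; rewrite !adjE eq_sym [q _ == _]eq_sym. Qed.

Lemma p_other (i i' : I) : exists x, (p x != i) && (p x != i').
Proof. by have [z] := exists_other i i' cardI; have [x <-] := p_surj z => ?; exists x. Qed.

Lemma q_other (j j' : J) : exists y, (q y != j) && (q y != j').
Proof. by have [z] := exists_other j j' cardJ; have [y <-] := q_surj z => ?; exists y. Qed.

Lemma three_cpd :
  exists2 S : {set T * U}, connected_power_dominating adj S & #|S| = 3.
Proof.
have /card_gt0P[i _] : 0 < #|I| by apply: leq_trans cardI.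
have /card_gt0P[j _] : 0 < #|J| by apply: leq_trans cardJ.
have [a _] := p_surj i; have [b _] := q_surj j.
have [a' /andP[a'a _]] := p_other (p a) (p a).
have [b' /andP[b'b _]] := q_other (q b) (q b).
have [c /andP[ca ca']] := p_other (p a) (p a').
have [d /andP[db db']] := q_other (q b) (q b').
pose x := (a, b); pose y := (a', b'); pose z := (c, d).
have xy : adj x y by rewrite adj_sym adjE a'a.
have xz : adj x z by rewrite adj_sym adjE ca.
have yz : adj y z by rewrite adj_sym adjE ca'.
have adj_neq u v : adj u v -> u != v.
  by apply: contraTneq => ->; rewrite adj_irr.
exists [set x; y; z]; last first.
  by rewrite setUC cardsU1 cards2 !inE !(eq_sym z) !negb_or !adj_neq.
apply/andP; split.
  suff -> : power_dominating adj [set x; y; z] by [].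
  rewrite /power_dominating (_ : closed_nbhd _ _ = setT) ?connect0 //.
  apply/eqP; rewrite -subTset; apply/subsetP => -[u v] _.
  rewrite in_closed_nbhd; apply/orP; right.
  apply: contraTT isT => /exists_inPn none.
  have := none x; have := none y; have := none z; rewrite !inE !eqxx !orbT /=.
  rewrite !adjE !negb_and !negbK /=.
  (* Each of [x], [y], [z] shares the first or the second part with [(u, v)]. By pigeonhole two of
     them share it in the same coordinate, against the choice of distinct parts. *)
  move=> /(_ isT) /orP hz /(_ isT) /orP hy /(_ isT) /orP hx.
  move: a'a b'b ca ca' db db'.
  by case: hx => /eqP ->; case: hy => /eqP ->; case: hz => /eqP ->; rewrite ?eqxx.
apply: clique_connected => u v; rewrite !inE.
by move=> /orP[/orP[]|] /eqP -> /orP[/orP[]|] /eqP ->; rewrite ?eqxx // adj_sym.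
Qed.

Lemma two_cpd a c b d :
    p a != p c -> q b != q d ->
    (forall x, p x = p a -> x = a) -> (forall x, p x = p c -> x = c) ->
    (forall y, q y = q b -> y = b) -> (forall y, q y = q d -> y = d) ->
  exists2 S : {set T * U}, connected_power_dominating adj S & #|S| = 2.
Proof.
move=> ac bd pa pc qb qd.
have neq_ac : a != c by apply: contraNneq ac => ->.
have neq_bd : b != d by apply: contraNneq bd => ->.
exists [set (a, b); (c, d)]; last by rewrite cards2 xpair_eqE (negPf neq_ac).
apply/andP; split; last first.
  apply: clique_connected => u v; rewrite !inE.
  move=> /orP[] /eqP -> /orP[] /eqP ->; rewrite ?eqxx // adjE /= ?ac ?bd //.
  by move=> _; rewrite eq_sym ac eq_sym bd.
have p_eq x : ((p x == p a) = (x == a)) * ((p x == p c) = (x == c)).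
  by split; apply/eqP/eqP => [|->//]; [apply: pa | apply: pc].
have q_eq y : ((q y == q b) = (y == b)) * ((q y == q d) = (y == d)).
  by split; apply/eqP/eqP => [|->//]; [apply: qb | apply: qd].
have [e /andP[ea ec]] := p_other (p a) (p c).
have [f /andP[fb fd]] := q_other (q b) (q d).
(* With all four parts singletons, the two undominated blocks are single vertices. *)
pose W := [set (a, d); (c, b)].
have closedE : closed_nbhd adj [set (a, b); (c, d)] = ~: W.
  apply/setP => -[x y]; rewrite in_closed_nbhd !inE !xpair_eqE.
  have -> : [exists v in [set (a, b); (c, d)], adj v (x, y)] =
            adj (a, b) (x, y) || adj (c, d) (x, y).
    apply/exists_inP/orP => [[v]|[] ?].
    - by rewrite !inE => /orP[] /eqP -> ?; [left | right].
    - by exists (a, b); rewrite ?set21.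
    - by exists (c, d); rewrite ?set22.
  rewrite !adjE /= !(eq_sym _ (p x)) !(eq_sym _ (q y)) !p_eq !q_eq.
  have : ~~ ((x == a) && (x == c)).
    by apply: contra neq_ac => /andP[/eqP <- /eqP <-].
  have : ~~ ((y == b) && (y == d)).
    by apply: contra neq_bd => /andP[/eqP <- /eqP <-].
  by case: (x == a); case: (x == c); case: (y == b); case: (y == d).
rewrite /power_dominating closedE.
(* [(c, f)] is adjacent to [(a, d)] but shares its first part with [(c, b)], so it forces
   [(a, d)]. *)
apply: (@connect_trans _ _ (~: (W :\ (a, d)))).
  apply/connect1/(@propagates_setC _ _ _ (c, f)).
    rewrite !inE !xpair_eqE eq_sym (negPf neq_ac) eqxx /=.
    by apply: contraNneq fb => ->.
  apply/setP => u; rewrite !inE !adjE.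
  have [->|uad] /= := eqVneq u (a, d); first by rewrite eq_sym ac fd.
  by have [->|] := eqVneq u (c, b); rewrite ?eqxx ?andbF.
rewrite -setC0 -(_ : W :\ (a, d) :\ (c, b) = set0); last first.
  by apply/setP => u; rewrite !inE; do 2!case: (u == _).
(* [(e, f)] is adjacent to both vertices of [W]; since [(a, d)] is now monitored, it forces
   [(c, b)]. *)
apply/connect1/(@propagates_setC _ _ _ (e, f)).
  rewrite !inE !xpair_eqE /= andbC; apply/negP => /andP[/orP[] /andP[/eqP h _] _].
    by rewrite h eqxx in ea.
  by rewrite h eqxx in ec.
apply/setP => u; rewrite !inE !adjE.
have [->|ucb] := eqVneq u (c, b).
  by rewrite /= ec fb xpair_eqE eq_sym (negPf neq_ac).
by case: (u == (a, d)); rewrite ?andbF.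
Qed.

Lemma cpd_ge2 (S : {set T * U}) : power_dominating adj S -> 1 < #|S|.
Proof.
move=> pdS.
have /card_gt0P[i _] : 0 < #|I| by apply: leq_trans cardI.
have /card_gt0P[j _] : 0 < #|J| by apply: leq_trans cardJ.
have [a0 _] := p_surj i; have [b0 _] := q_surj j.
have TU_gt0 : 0 < #|{: T * U}| by apply/card_gt0P; exists (a0, b0).
have := power_dominating_neq0 TU_gt0 pdS.
rewrite -card_gt0 leq_eqVlt => /orP[|//]; rewrite eq_sym => /cards1P[[a b] defS].
subst S.
pose F := [set u : T * U | ~~ adj (a, b) u & u != (a, b)].
have disjF : [disjoint closed_nbhd adj [set (a, b)] & F].
  apply/pred0Pn => -[u /andP[]]; rewrite /= in_closed_nbhd !inE.
  case/orP=> [->|/exists_inP[v]]; first by rewrite andbF.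
  by rewrite inE => /eqP -> ->.
apply: contraLR pdS => _; apply: (fort_not_power_dominating _ disjF).
split.
  have [c /andP[ca _]] := p_other (p a) (p a).
  apply/set0Pn; exists (c, b); rewrite !inE adjE /= eqxx andbF xpair_eqE /=.
  by rewrite eqxx andbT; apply: contraNneq ca => ->.
move=> v w; rewrite inE negb_and !negbK => /orP[abv|/eqP ->]; last first.
  by rewrite inE => /andP[/negP].
(* For [v] adjacent to [(a, b)], both [(c, b)] and [(a, d)] lie in [F] and are neighbours of [v].
   They are distinct, so one of them differs from [w]. *)
move=> _ _; have [c /andP[ca cv]] := p_other (p a) (p v.1).
have [d /andP[db dv]] := q_other (q b) (q v.2).
rewrite eq_sym in cv; rewrite eq_sym in dv.
have /andP[/= va vb] : adj v (a, b) by rewrite adj_sym.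
have neq_ca : c != a by apply: contraNneq ca => ->.
have neq_db : d != b by apply: contraNneq db => ->.
have [weq|wneq] := eqVneq w (a, d); last first.
  exists (a, d); rewrite eq_sym wneq !inE !adjE /= eqxx xpair_eqE eqxx neq_db.
  by rewrite va dv.
exists (c, b); rewrite weq !inE !adjE /= !xpair_eqE !eqxx (negPf neq_ca) andbF /=.
by rewrite cv vb.
Qed.

(** Stated for any block missed by the closed neighbourhood, so that it applies to both blocks left
    by an adjacent pair. A second vertex in the block would be a twin of [(a, d)] and make the block
    a fort. *)
Lemma block_singleton (S : {set T * U}) (a x : T) (d y : U) :
    power_dominating adj S ->
    (forall u, u \in closed_nbhd adj S -> ~~ ((p u.1 == p a) && (q u.2 == q d))) ->
  p x = p a -> q y = q d -> (x, y) = (a, d).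
Proof.
move=> pdS undom px qy; apply: contraTeq pdS => neq.
pose F := [set u : T * U | (p u.1 == p a) && (q u.2 == q d)].
have inF u : u \in F -> (p u.1 = p a) * (q u.2 = q d).
  by rewrite inE => /andP[/eqP -> /eqP ->].
have adF : (a, d) \in F by rewrite inE !eqxx.
have xyF : (x, y) \in F by rewrite inE px qy !eqxx.
apply: (@fort_not_power_dominating _ _ _ F).
  split=> [|v w _ wF vw]; first by apply/set0Pn; exists (a, d).
  have adjF w' : w' \in F -> adj v w'.
    by move=> w'F; move: vw; rewrite !adjE !(inF w wF) !(inF w' w'F).
  have [weq|wneq] := eqVneq w (a, d).
    by exists (x, y); rewrite weq neq xyF adjF.
  by exists (a, d); rewrite eq_sym wneq adF adjF.
by apply/pred0Pn => -[u /andP[/= /undom]]; rewrite inE => /negPf ->.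
Qed.

Lemma cpd2_singletons (S : {set T * U}) :
    connected_power_dominating adj S -> #|S| = 2 ->
  exists a c b d,
    [/\ p a != p c, q b != q d,
        (forall x, p x = p a -> x = a) /\ (forall x, p x = p c -> x = c) &
        (forall y, q y = q b -> y = b) /\ (forall y, q y = q d -> y = d)].
Proof.
case/andP=> pdS connS /eqP/cards2P[[a b] [[c d] [neq defS]]].
subst S.
have /andP[/= ac bd] := connected_pair_adj adj_irr neq connS.
have undom u : u \in closed_nbhd adj [set (a, b); (c, d)] ->
    ~~ ((p u.1 == p a) && (q u.2 == q d)) /\
    ~~ ((p u.1 == p c) && (q u.2 == q b)).
  rewrite in_closed_nbhd !inE => /orP[/orP[] /eqP ->|/exists_inP[v]] /=.
  - by rewrite (negPf ac) (negPf bd) andbF.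
  - by rewrite eq_sym (negPf ac) eq_sym (negPf bd) andbF.
  rewrite !inE => /orP[] /eqP ->; rewrite adjE /= => /andP[pu qu]; split.
  - by rewrite eq_sym (negPf pu).
  - by rewrite andbC eq_sym (negPf qu).
  - by rewrite andbC eq_sym (negPf qu).
  - by rewrite eq_sym (negPf pu).
have ad x y := block_singleton (x := x) (y := y) pdS (fun u h => (undom u h).1).
have cb x y := block_singleton (x := x) (y := y) pdS (fun u h => (undom u h).2).
exists a, c, b, d; split=> //; split.
- by move=> x /ad /(_ (erefl (q d))) [].
- by move=> x /cb /(_ (erefl (q b))) [].
- by move=> y /(cb _ _ (erefl (p c))) [].
- by move=> y /(ad _ _ (erefl (p a))) [].
Qed.

End MultipartiteProduct.

(** * Singleton parts in terms of the sorted part sizes *)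

Section Parts.

Variables (r : nat) (n : r.-tuple nat).
Hypotheses (r_ge3 : 3 <= r) (n_ge1 : 1 <= nth 0 n 0) (n_sorted : sorted leq n).

Let nth_le i j : i <= j -> j < r -> nth 0 n i <= nth 0 n j.
Proof.
move=> ij jr; apply: (sorted_leq_nth leq_trans leqnn) => //;
  rewrite inE size_tuple //; exact: leq_ltn_trans jr.
Qed.

Lemma part_inhabited (i : 'I_r) : exists x : multipartite_vertex n, tag x = i.
Proof.
have lt0 : 0 < tnth n i by rewrite (tnth_nth 0) (leq_trans n_ge1) ?nth_le.
by exists (Tagged (fun i => 'I_(tnth n i)) (Ordinal lt0)).
Qed.

Lemma singleton_partP (a : multipartite_vertex n) :
  tnth n (tag a) = 1 <-> forall x : multipartite_vertex n, tag x = tag a -> x = a.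
Proof.
case: a => i y; split=> /= [ni [j z] /= ji|uniq_y].
  subst j; congr Tagged; apply: val_inj.
  have val0 (u : 'I_(tnth n i)) : u = 0 :> nat.
    by apply/eqP; rewrite -leqn0 -ltnS -[ltnRHS]ni.
  exact: etrans (val0 z) (esym (val0 y)).
have : #|'I_(tnth n i)| = 1.
  apply/eqP/fintype1P; exists y => z.
  have /eqP := uniq_y (Tagged (fun i => 'I_(tnth n i)) z) erefl.
  by rewrite eq_Tagged => /eqP.
by rewrite card_ord.
Qed.

Lemma two_singleton_partsP :
  (nth 0 n 0 == 1) && (nth 0 n 1 == 1) <->
  exists a c : multipartite_vertex n,
    [/\ tag a != tag c, forall x : multipartite_vertex n, tag x = tag a -> x = a
      & forall x : multipartite_vertex n, tag x = tag c -> x = c].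
Proof.
split=> [/andP[/eqP n0 /eqP n1]|[a [c [ac /singleton_partP na /singleton_partP nc]]]].
  have r_gt1 : 1 < r := ltnW r_ge3.
  have [a defa] := part_inhabited (Ordinal (ltnW r_gt1)).
  have [c defc] := part_inhabited (Ordinal r_gt1).
  exists a, c; split; first by rewrite defa defc.
    by apply/singleton_partP; rewrite defa (tnth_nth 0).
  by apply/singleton_partP; rewrite defc (tnth_nth 0).
have r_gt1 : 1 < r := ltnW r_ge3.
(* Of two distinct parts of size 1, at least one has positive index, and by sortedness its size
   bounds the entry at index 1. *)
have n1_le1 : nth 0 n 1 <= 1.
  move: na nc; rewrite !(tnth_nth 0) => na nc.
  have [a0|a_gt0] := posnP (tag a); last first.
    by have := nth_le a_gt0 (ltn_ord (tag a)); rewrite na.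
  have c_gt0 : 0 < tag c.
    by rewrite lt0n; apply: contraNneq ac => c0; apply/eqP/val_inj; rewrite /= a0 c0.
  by have := nth_le c_gt0 (ltn_ord (tag c)); rewrite nc.
have n01 := nth_le (leq0n 1) r_gt1.
by rewrite !eqn_leq n_ge1 n1_le1 (leq_trans n01 n1_le1) (leq_trans n_ge1 n01).
Qed.

End Parts.

Theorem theorem16 (t k : nat) (n : t.-tuple nat) (m : k.-tuple nat)
    (ht : 3 <= t) (hk : 3 <= k)
    (hn1 : 1 <= nth 0 n 0) (hn : sorted leq n)
    (hm1 : 1 <= nth 0 m 0) (hm : sorted leq m) :
  gamma_Pc (tensor_adj (@multipartite_adj t n) (@multipartite_adj k m)) =
  if [&& nth 0 n 0 == 1, nth 0 n 1 == 1, nth 0 m 0 == 1 & nth 0 m 1 == 1]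
  then 2 else 3.
Proof.
have n_inh := part_inhabited hn1 hn; have m_inh := part_inhabited hm1 hm.
have cardI : 2 < #|'I_t| by rewrite card_ord.
have cardJ : 2 < #|'I_k| by rewrite card_ord.
have ge2 := cpd_ge2 n_inh m_inh cardI cardJ.
rewrite andbA; case: ifP => [/andP[nP mP]|not_singl].
  have [a [c [ac pa pc]]] := (two_singleton_partsP ht hn1 hn).1 nP.
  have [b [d [bd qb qd]]] := (two_singleton_partsP hk hm1 hm).1 mP.
  have [S cpdS cardS] := two_cpd n_inh m_inh cardI cardJ ac bd pa pc qb qd.
  by rewrite (gamma_Pc_eq cpdS) // cardS => S' /andP[/ge2].
have [S cpdS cardS] := three_cpd n_inh m_inh cardI cardJ.
rewrite (gamma_Pc_eq cpdS) // cardS => S' cpdS'.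
have /andP[/ge2 ge2S' _] := cpdS'; rewrite ltn_neqAle ge2S' andbT.
(* A connected power dominating set of size 2 would produce two singleton parts in each factor. *)
apply: contraFneq not_singl => /esym cardS'.
have [a [c [b [d [ac bd [pa pc] [qb qd]]]]]] := cpd2_singletons cpdS' cardS'.
apply/andP; split.
  by apply/(two_singleton_partsP ht hn1 hn); exists a, c.
by apply/(two_singleton_partsP hk hm1 hm); exists b, d.
Qed.
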